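(* Let $s\ge1$. If $f\in C^2(\mathbb{R}^s)$ and $H_n(f)<\infty$ for some $n\in\mathbb{N}_0$, then for any $n_0\in\mathbb{N}_0$ there exists a constant $C>0$ depending only on $n_0$ and $f$ such that $$\left|\sum_{\alpha\in\mathbb{Z}^s}\left|\hat{\boldsymbol d}_\alpha^n(f)\right|_2-\|f\|_{TV}\right|\le C\,2^{-n}\int_{\mathbb{R}^s}\left|D^2f(x)\right|_F\,dx\qquad\text{for all } n\ge n_0.$$
   Context: Univariate Haar functions: $\psi_0:=\chi_{[0,1]}$, $\psi_1:=\chi_{[0,\frac12]}-\chi_{[\frac12,1]}$; for $\theta\in\{0,1\}^s$, $\psi_\theta(x):=\prod_{j=1}^s\psi_{\theta_j}(x_j)$, and $d_{\theta,\alpha}^n(f):=2^{ns/2}\int_{\mathbb{R}^s}f(t)\psi_\theta(2^nt-\alpha)\,dt$ for $n\in\mathbb{N}_0$, $\alpha\in\mathbb{Z}^s$. Let $\epsilon_j\in\{0,1\}^s$ denote the $j$-th unit vector, and define $\hat{\boldsymbol d}_\alpha^n(f):=-2^{n(1-s/2)+2}\big(d^n_{\epsilon_1,\alpha}(f),\dots,d^n_{\epsilon_s,\alpha}(f)\big)\in\mathbb{R}^s$. $|\cdot|_2$ is the Euclidean norm, $\|f\|_{TV}:=\int_{\mathbb{R}^s}|\nabla f(x)|_2\,dx$. The Frobenius norm of the Hessian is $|D^2f(x)|_F:=\big(\sum_{j,k=1}^s(\partial^2f(x)/\partial x_j\partial x_k)^2\big)^{1/2}$. With $x_\alpha^n:=2^{-n}(\alpha+\frac12(1,\dots,1))$,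 $H_n(f):=\sum_{\alpha\in\mathbb{Z}^s}2^{-ns}\max_{x\in x_\alpha^n+2^{-n}[-\frac12,\frac12]^s}|D^2f(x)|_F$ (possibly $+\infty$). *)

(* Defs.v *)
From HB Require Import structures.
From mathcomp Require Import all_boot all_order all_algebra.
From mathcomp Require Import all_classical all_reals all_analysis.
Set Implicit Arguments. Unset Strict Implicit. Unset Printing Implicit Defensive.
Import Order.TTheory GRing.Theory Num.Theory.
Import numFieldNormedType.Exports.
Local Open Scope classical_set_scope.
Local Open Scope ring_scope.

Section Defs.
Variable R : realType.

Definition unitv (s : nat) (j : 'I_s) : 'rV[R]_s := \row_(k < s) (k == j)%:R.

Definition partial (s : nat) (j : 'I_s) (f : 'rV[R]_s -> R) : 'rV[R]_s -> R :=
  fun x => derive f x (unitv j).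

Definition C2 (s : nat) (f : 'rV[R]_s -> R) : Prop :=
  continuous f /\
  (forall j x, derivable f x (unitv j)) /\
  (forall j, continuous (partial j f)) /\
  (forall j k x, derivable (partial j f) x (unitv k)) /\
  (forall j k, continuous (partial k (partial j f))).

Definition grad_norm (s : nat) (f : 'rV[R]_s -> R) (x : 'rV[R]_s) : R :=
  Num.sqrt (\sum_(j < s) (partial j f x) ^+ 2).

Definition hess_frob (s : nat) (f : 'rV[R]_s -> R) (x : 'rV[R]_s) : R :=
  Num.sqrt (\sum_(j < s) \sum_(k < s) (partial k (partial j f) x) ^+ 2).

(* Lebesgue integral over R^s, written as the iterated Lebesgue integral
   over the coordinates x_0, ..., x_{s-1} (Fubini/Tonelli). *)
Fixpoint iint (s : nat) : ('rV[R]_s -> \bar R) -> \bar R :=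
  match s return ('rV[R]_s -> \bar R) -> \bar R with
  | 0 => fun g => g 0
  | s'.+1 => fun g =>
      (\int[@lebesgue_measure R]_t
         iint (fun y : 'rV[R]_s' => g (row_mx (const_mx t : 'rV[R]_1) y)))%E
  end.

Definition psi0 (x : R) : R := (\1_(`[0, 1]%classic) x).
Definition psi1 (x : R) : R :=
  (\1_(`[0, 2^-1]%classic) x) - (\1_(`[2^-1, 1]%classic) x).
Definition psi (b : bool) : R -> R := if b then psi1 else psi0.

Definition psi_theta (s : nat) (theta : 'I_s -> bool) (x : 'rV[R]_s) : R :=
  \prod_(j < s) psi (theta j) (x ord0 j).

Definition haar_coef (s : nat) (n : nat) (theta : 'I_s -> bool)
  (alpha : 'rV[int]_s) (f : 'rV[R]_s -> R) : R :=
  2 `^ (n%:R * s%:R / 2) *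
  fine (iint (fun t => (f t * psi_theta theta
           ((2 ^+ n) *: t - map_mx (fun z : int => z%:~R) alpha))%:E)).

Definition eps (s : nat) (j : 'I_s) : 'I_s -> bool := fun k => k == j.

Definition dhat (s : nat) (n : nat) (alpha : 'rV[int]_s) (f : 'rV[R]_s -> R)
  : 'rV[R]_s :=
  \row_(j < s) (- 2 `^ (n%:R * (1 - s%:R / 2) + 2) * haar_coef n (eps j) alpha f).

Definition norm2 (s : nat) (v : 'rV[R]_s) : R :=
  Num.sqrt (\sum_(j < s) (v ord0 j) ^+ 2).

Definition sum_dhat (s : nat) (n : nat) (f : 'rV[R]_s -> R) : \bar R :=
  (\esum_(alpha in [set: 'rV[int]_s]) (norm2 (dhat n alpha f))%:E)%E.

Definition TV (s : nat) (f : 'rV[R]_s -> R) : \bar R :=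
  iint (fun x => (grad_norm f x)%:E).

Definition hess_int (s : nat) (f : 'rV[R]_s -> R) : \bar R :=
  iint (fun x => (hess_frob f x)%:E).

Definition cube (s : nat) (n : nat) (alpha : 'rV[int]_s) : set 'rV[R]_s :=
  [set x | exists2 y : 'rV[R]_s, (forall j, -(2^-1) <= y ord0 j <= 2^-1) &
     x = (2 ^- n) *: (map_mx (fun z : int => z%:~R) alpha
                        + const_mx (2^-1)) + (2 ^- n) *: y].

Definition H (s : nat) (n : nat) (f : 'rV[R]_s -> R) : \bar R :=
  (\esum_(alpha in [set: 'rV[int]_s])
     ((2 ^- (n * s))%:E *
      ereal_sup [set (hess_frob f x)%:E | x in cube n alpha]))%E.

End Defs.

(* Main.v *)
Require Import Defs.
From HB Require Import structures.
From mathcomp Require Import all_boot all_order all_algebra.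
From mathcomp Require Import all_classical all_reals all_analysis.
From mathcomp Require Import measurable_realfun ring lra.
Set Implicit Arguments. Unset Strict Implicit. Unset Printing Implicit Defensive.
Import Order.TTheory GRing.Theory Num.Theory.
Import numFieldNormedType.Exports.
Local Open Scope classical_set_scope.
Local Open Scope ring_scope.

(** Let [h = 2^-n].  On a dyadic cube [Q] of side [h] with centre [x0], the Haar
coefficient vector of an affine function is exactly [h^s] times its gradient.
Replacing [f] by its first-order Taylor polynomial at [x0], and [grad f] by
[grad f x0], costs [O(h * h^s * max_Q |D^2 f|)], so summing over the cubes bounds
the difference by [O(h * H_n)].  Refining cubes decreases [H_n] and coarsening
multiplies it by at most a power of two, so [H_n] is bounded uniformly in [n]
once it is finite for one [n].  Hence [C] can be taken proportional to
[sup_n H_n / \int |D^2 f|]; the quotient degenerates only when [D^2 f] vanishes,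
and then every [H_n] is zero.

The iterated integral is only ever compared by monotonicity with integrals of
functions constant on dyadic cubes or of finite sums of products of
one-variable functions, so neither Fubini's theorem nor the measurability of
partial integrals is needed. *)

(** * Monotonicity and dyadic step functions *)

(* No measurability is needed: the integral of a nonnegative function is defined
   as the supremum of the integrals of the simple functions below it. *)
Lemma le_integral_pointwise d (T : measurableType d) (R : realType)
    (mu : {measure set T -> \bar R}) (f g : T -> \bar R) :
  (forall x, (f x <= g x)%E) ->
  (\int[mu]_x f x <= \int[mu]_x g x)%E.
Proof.
move=> fg; rewrite /integral !patch_setT.
apply: leeB; apply: le_ereal_sup => _ [h hle <-]; exists h => // x;
  apply: (le_trans (hle x)).
- by apply: (@funepos_le _ _ setT) => //; rewrite inE.
- by apply: (@funeneg_le _ _ setT) => //; rewrite inE.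
Qed.

Section Integrals.
Variable R : realType.
Local Notation mu := (@lebesgue_measure R).

Lemma le_iint s (f g : 'rV[R]_s -> \bar R) :
  (forall x, (f x <= g x)%E) -> (iint f <= iint g)%E.
Proof.
elim: s f g => [|s IH] f g fg /=; first exact: fg.
by apply: le_integral_pointwise => t; exact: IH.
Qed.

Lemma eq_iint s (f g : 'rV[R]_s -> \bar R) :
  f =1 g -> iint f = iint g.
Proof. by move=> /funext ->. Qed.

Lemma floor_preimage (c : R) (k : int) : 0 < c ->
  [set t | Num.floor (c * t) = k] = `[k%:~R / c, (k + 1)%:~R / c[%classic.
Proof.
move=> c0; apply/seteqP; split => t /=; rewrite in_itv /= ler_pdivrMr// ltr_pdivlMr// (mulrC t).
  by move=> <-; exact: floor_itv.
by move=> H; exact: floor_def.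
Qed.

Lemma lebesgue_floor_preimage (c : R) (k : int) : 0 < c ->
  mu [set t | Num.floor (c * t) = k] = (c^-1)%:E.
Proof.
move=> c0; rewrite floor_preimage// lebesgue_measure_itv /=.
rewrite lte_fin ltr_pM2r ?invr_gt0// ltr_int ltrDl ltr01.
by rewrite -EFinB -mulrBl -intrB [k + 1]addrC addrK mul1r.
Qed.

Lemma measurable_floor_preimage (c : R) (k : int) : 0 < c ->
  measurable [set t : R | Num.floor (c * t) = k].
Proof. by move=> c0; rewrite floor_preimage. Qed.

(** Since [int] is countable, every preimage is a countable union of floor level sets, which are
    half-open intervals. *)
Lemma measurable_fun_floor (c : R) (G : int -> \bar R) : 0 < c ->
  measurable_fun [set: R] (G \o (fun t : R => Num.floor (c * t))).
Proof.
move=> c0 _ B mB; rewrite setTI.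
rewrite (_ : _ @^-1` B = \bigcup_k (if G k \in B then
    [set t : R | Num.floor (c * t) = k] else set0)); last first.
  apply/seteqP; split=> t /=.
    by move=> Bt; exists (Num.floor (c * t)) => //; rewrite mem_set.
  by case=> k _; case: ifPn => // /[!inE] Bk /= ->.
apply: countable_bigcupT_measurable; first exact: countableP.
by move=> k; case: ifPn => // _; exact: measurable_floor_preimage.
Qed.

Lemma integral_floor (c : R) (G : int -> \bar R) : 0 < c ->
  (forall k, 0 <= G k)%E ->
  (\int[mu]_t G (Num.floor (c * t)) = \esum_(k in [set: int]) (c^-1)%:E * G k)%E.
Proof.
move=> c0 G0.
(* Countable additivity over [int], whose elements are numbered by [pickle]. *)
pose F (i : nat) : set R := [set t | pickle (Num.floor (c * t)) = i].
have Fpickle k : F (pickle k) = [set t : R | Num.floor (c * t) = k].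
  by rewrite /F; apply/seteqP; split=> t /= => [/(pcan_inj pickleK)|->].
have Fempty i : ~ range (@pickle int) i -> F i = set0.
  by move=> H; apply/seteqP; split => // t /= Ht; apply: H; exists (Num.floor (c * t)).
have mF i : measurable (F i).
  have [[k _ <-]|/Fempty ->//] := pselect (range (@pickle int) i).
  by rewrite Fpickle; exact: measurable_floor_preimage.
have UF : \bigcup_i F i = setT.
  by apply/seteqP; split=> t // _; exists (pickle (Num.floor (c * t))).
have tF : trivIset setT F.
  by apply/trivIsetP => i j _ _ ij; apply/seteqP; split => // t [/= Hi Hj];
     move/eqP: ij; apply; rewrite -Hi -Hj.
have mG := measurable_fun_floor G c0.
rewrite -UF ge0_integral_bigcup// ?UF//.
rewrite nneseries_esumT; last by move=> i; exact: integral_ge0.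
(* Numbers that code no integer have an empty piece [F i] and contribute zero. *)
rewrite (_ : esum _ _ = \esum_(i in range (@pickle int))
     \int[mu]_(t in F i) G (Num.floor (c * t)))%E; last first.
  rewrite [RHS]esum_mkcond; apply: eq_esum => i _.
  case: ifPn => // /negP; rewrite inE => /Fempty ->.
  by rewrite integral_set0.
rewrite esum_image; last by move=> k l _ _; exact: (pcan_inj pickleK).
apply: eq_esum => k _; rewrite Fpickle.
rewrite (@eq_integral _ _ _ _ _ (cst (G k))); last by move=> t /[!inE] Ht /=; congr G.
rewrite integral_cst; last exact: measurable_floor_preimage.
by rewrite muleC; congr (_ * _)%E; exact: lebesgue_floor_preimage.
Qed.
End Integrals.

Lemma ge0_esumZl (R : realType) (T : choiceType) (I : set T) (a : T -> \bar R) (c : R) :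
  0 < c -> (forall i, 0 <= a i)%E ->
  (\esum_(i in I) (c%:E * a i) = c%:E * \esum_(i in I) a i)%E.
Proof.
move=> c0 a0; rewrite /esum -ereal_sup_pZl//; congr ereal_sup.
rewrite image_comp; apply: eq_imagel => X [finX _] /=.
by rewrite !fsbig_finite//= ge0_sume_distrr.
Qed.

Section Iint.
Variable R : realType.

(** Index of the half-open cube of side [c^-1] containing [x]. These cubes partition the space,
    whereas the closed sets [cube n alpha] share faces. *)
Definition floor_mx s (c : R) (x : 'rV[R]_s) : 'rV[int]_s :=
  map_mx (fun t => Num.floor (c * t)) x.

Lemma esum_row_mx s (a : 'rV[int]_(1 + s) -> \bar R) :
  (forall i, 0 <= a i)%E ->
  (\esum_(i in [set: 'rV[int]_(1 + s)]) a i =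
   \esum_(k in [set: int]) \esum_(j in [set: 'rV[int]_s])
      a (row_mx (const_mx k) j))%E.
Proof.
move=> a0; rewrite esum_esum//.
pose e (p : int * 'rV[int]_s) := row_mx (const_mx p.1 : 'rV[int]_1) p.2.
apply: (@reindex_esum _ _ _ _ _ e); split => //.
- move=> [k j] [k' j'] _ _ /= /eq_row_mx[/matrixP/(_ ord0 ord0)].
  by rewrite !mxE /= => -> ->.
- move=> i _; exists (lsubmx i ord0 ord0, rsubmx i) => //=.
  rewrite -[RHS]hsubmxK; congr row_mx.
  by apply/matrixP => u v; rewrite !mxE !ord1.
Qed.

(** Induction on the dimension: the inner iterated integral again depends on the first coordinate
    only through its floor, so [integral_floor] applies to it. *)
Lemma iint_floor s (c : R) (F : 'rV[int]_s -> \bar R) : 0 < c ->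
  (forall k, 0 <= F k)%E ->
  iint (fun x => F (floor_mx c x)) =
    (\esum_(k in [set: 'rV[int]_s]) (c^-1 ^+ s)%:E * F k)%E.
Proof.
move=> c0; elim: s F => [|s IH] F F0 /=.
  rewrite (_ : setT = [set 0 : 'rV[int]_0]); last first.
    by apply/seteqP; split => // x _; rewrite /= thinmx0.
  by rewrite esum_set1 ?expr0 ?mul1e// thinmx0.
have c1 : 0 < c^-1 by rewrite invr_gt0.
rewrite (_ : setT = [set: 'rV[int]_(1 + s)])// esum_row_mx; last first.
  by move=> k; rewrite mule_ge0// lee_fin exprn_ge0// ltW.
pose G (k : int) : \bar R := (\esum_(j in [set: 'rV[int]_s])
   ((c^-1) ^+ s)%:E * F (row_mx (const_mx k : 'rV_1) j))%E.
have G0 k : (0 <= G k)%E.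
  by apply: esum_ge0 => j _; rewrite mule_ge0// lee_fin exprn_ge0// ltW.
transitivity (\int[@lebesgue_measure R]_t G (Num.floor (c * t)))%E.
  apply: eq_integral => t _.
  rewrite /G -(IH (fun j => F (row_mx (const_mx (Num.floor (c * t)) : 'rV_1) j)))//.
  apply: eq_iint => y.
  congr F; rewrite /floor_mx (map_row_mx _ (const_mx t : 'rV[R]_1) y).
  by rewrite map_const_mx.
rewrite integral_floor//; apply: eq_esum => k _.
rewrite -ge0_esumZl//; last by move=> j; rewrite mule_ge0// lee_fin exprn_ge0// ltW.
by apply: eq_esum => j _; rewrite muleA -EFinM -exprS.
Qed.
End Iint.

(** * Haar coefficients of affine functions *)

Section Products.
Variable R : realType.
Local Notation mu := (@lebesgue_measure R).

(** The coefficients [c] make the induction run: for a fixed first coordinate [t], the factor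
    [phi i ord0 t] is absorbed into them, and the inner integral has the same shape in one dimension
    less. *)
Lemma iint_sum_prod (I : Type) (r : seq I) (c : I -> R) s (phi : I -> 'I_s -> R -> R) :
  (forall i j, mu.-integrable setT (EFin \o phi i j)) ->
  iint (fun x => (\sum_(i <- r) c i * \prod_(j < s) phi i j (x ord0 j))%:E) =
  (\sum_(i <- r) c i * \prod_(j < s) (\int[mu]_t phi i j t)%R)%:E.
Proof.
elim: s c phi => [|s IH] c phi iphi /=.
  by congr EFin; apply: eq_bigr => i _; rewrite !big_ord0.
pose P i := \prod_(j < s) (\int[mu]_t phi i (lift ord0 j) t)%R.
transitivity (\int[mu]_t \sum_(i <- r) ((c i * P i)%:E * (phi i ord0 t)%:E))%E.
  apply: eq_integral => t _.
  transitivity (iint (fun y : 'rV[R]_s => (\sum_(i <- r) (c i * phi i ord0 t) *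
      \prod_(j < s) phi i (lift ord0 j) (y ord0 j))%:E)).
    apply: eq_iint => y; congr EFin; apply: eq_bigr => i _.
    rewrite big_ord_recl mulrA; congr (_ * phi _ _ _ * _).
      have -> : ord0 = lshift s (ord0 : 'I_1) by apply/val_inj.
      by rewrite (row_mxEl (const_mx t : 'rV[R]_1) y) mxE.
    apply: eq_bigr => j _; congr phi.
    have -> : lift ord0 j = rshift 1 j by apply/val_inj.
    by rewrite (row_mxEr (const_mx t : 'rV[R]_1) y).
  rewrite (IH (fun i => c i * phi i ord0 t) (fun i j => phi i (lift ord0 j)))//.
  rewrite -sumEFin; apply: eq_bigr => i _.
  by rewrite -EFinM mulrAC.
rewrite integral_sum//; last first.
  by move=> i; apply: integrableZl => //; exact: iphi.
rewrite -sumEFin; apply: eq_bigr => i _.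
rewrite integralZl//; last exact: iphi.
rewrite big_ord_recl EFinM mulrCA -/(P i) [in RHS]mulrC -EFinM [RHS]EFinM; congr (_ * _)%E.
by rewrite fineK//; apply: integrable_fin_num => //; exact: iphi.
Qed.

Lemma integral_affine (p q a b : R) : a < b ->
  mu.-integrable setT (EFin \o (fun t => (p + q * t) * \1_(`[a, b]%classic) t)) /\
  (\int[mu]_t ((p + q * t) * \1_(`[a, b]%classic) t))%R =
    p * (b - a) + q * ((b ^+ 2 - a ^+ 2) / 2).
Proof.
move=> ab.
pose F t : R := p * t + q * (t ^+ 2 / 2).
have cf : continuous (fun t : R => p + q * t).
  by move=> t; apply: cvgD; [exact: cvg_cst|apply: cvgMr; exact: cvg_id].
have dF t : is_derive t (1:R) F (p + q * t).
  by rewrite /F; apply: is_derive_eq; rewrite !scaler0 /GRing.scale /=; field.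
have cF : continuous F.
  move=> t; apply: differentiable_continuous; apply/derivable1_diffP.
  by have [] := dF t.
have E : (fun t => ((p + q * t) * \1_(`[a, b]%classic) t)%:E) =
   ((fun t => (p + q * t)%:E) \_ `[a, b]).
  by apply/funext => t; rewrite patchE indicE; case: ifPn => _; rewrite ?mulr1 ?mulr0.
split.
  rewrite (_ : _ \o _ = ((fun t => (p + q * t)%:E) \_ `[a, b])) -?integrable_mkcond//.
  by apply: continuous_compact_integrable; [exact: segment_compact|exact: continuous_subspaceT].
rewrite /Rintegral E -integral_mkcond (@continuous_FTC2 _ _ F)//.
- by rewrite -EFinB /= /F; field.
- exact: continuous_subspaceT.
- split => //.
    by apply: cvg_at_right_filter; exact: cF.
  by apply: cvg_at_left_filter; exact: cF.
- by move=> t _; rewrite derive1E; have [_] := dF t.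
Qed.
End Products.

Section Haar.
Variable R : realType.
Local Notation mu := (@lebesgue_measure R).

Lemma indic_itv_affine (c a u v t : R) : 0 < c ->
  \1_(`[u, v]%classic) (c * t - a) = \1_(`[(a + u) / c, (a + v) / c]%classic) t :> R.
Proof.
move=> c0; rewrite !indicE; congr (_%:R); congr nat_of_bool.
apply/idP/idP; rewrite !inE /= !in_itv /= ler_pdivrMr// ler_pdivlMr// lerBrDl lerBlDl (mulrC t)//.
Qed.

Lemma psi0_affine (c a t : R) : 0 < c ->
  psi0 (c * t - a) = \1_(`[a / c, (a + 1) / c]%classic) t.
Proof. by move=> c0; rewrite /psi0 indic_itv_affine// addr0. Qed.

Lemma psi1_affine (c a t : R) : 0 < c ->
  psi1 (c * t - a) = \1_(`[a / c, (a + 2^-1) / c]%classic) t -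
    \1_(`[(a + 2^-1) / c, (a + 1) / c]%classic) t.
Proof. by move=> c0; rewrite /psi1 !indic_itv_affine// addr0. Qed.

(** One coordinate of a Haar function times a monomial: [w] inserts the linear weight centred at the
    midpoint of the dyadic interval. *)
Definition haar_factor (c a : R) (b w : bool) (t : R) : R :=
  psi b (c * t - a) * (if w then t - (a + 2^-1) / c else 1).

(** About the midpoint [psi0] is even and [psi1] is odd, up to endpoints. Hence only the constant
    against [psi0] and the linear weight against [psi1] have a nonzero integral. *)
Lemma integral_haar_factor (c a : R) (b w : bool) : 0 < c ->
  mu.-integrable setT (EFin \o haar_factor c a b w) /\
  (\int[mu]_t haar_factor c a b w t)%R =
    if b then (if w then - (c^-1 ^+ 2 / 4) else 0) else (if w then 0 else c^-1).
Proof.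
move=> c0; set m := (a + 2^-1) / c.
have c'0 : c != 0 by rewrite gt_eqF.
have am : a / c < m by rewrite ltr_pM2r ?invr_gt0// ltrDl invr_gt0.
have mb : m < (a + 1) / c.
  by rewrite ltr_pM2r ?invr_gt0// ltrD2l invf_lt1// ltr1n.
pose p : R := if w then - m else 1.
pose q : R := if w then 1 else 0.
have pq t : (if w then t - m else 1) = p + q * t.
  by rewrite /p /q; case: ifP => _; rewrite ?mul1r ?mul0r ?addr0// addrC.
case: b.
- rewrite (_ : haar_factor c a true w = fun t =>
    (p + q * t) * \1_(`[a / c, m]%classic) t -
    (p + q * t) * \1_(`[m, (a + 1) / c]%classic) t); last first.
    by apply/funext => t; rewrite /haar_factor -/m pq /= psi1_affine// mulrC mulrBr.
  have [i1 e1] := integral_affine p q am.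
  have [i2 e2] := integral_affine p q mb.
  split.
    exact: (integrableB _ i1 i2).
  rewrite RintegralB// e1 e2 /p /q /m; by case: ifP => _; field; rewrite ?c'0.
- rewrite (_ : haar_factor c a false w = fun t =>
    (p + q * t) * \1_(`[a / c, (a + 1) / c]%classic) t); last first.
    by apply/funext => t; rewrite /haar_factor -/m pq /= psi0_affine// mulrC.
  have [i1 ->] := integral_affine p q (lt_trans am mb); split => //.
  rewrite /p /q /m; by case: ifP => _; field.
Qed.

Lemma psi0E (t : R) : psi0 t = ((0 <= t <= 1)%R)%:R.
Proof. by rewrite /psi0 indicE mem_setE in_itv. Qed.

Lemma psi_le_psi0 b (t : R) : `|psi b t| <= psi0 t.
Proof.
rewrite psi0E; case: b; last by rewrite /= psi0E ger0_norm.
rewrite /psi /psi1 !indicE !mem_setE !in_itv /=.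
(* At [t = 2^-1] both indicators equal 1 and cancel; elsewhere at most one is nonzero. *)
have [t0|t0] := leP 0 t; have [t1|t1] := leP t 1;
have [t2|t2] := leP t 2^-1; have [t3|t3] := leP 2^-1 t;
by rewrite /= ?subrr ?normr0 ?subr0 ?sub0r ?normrN ?normr1 ?ler01 ?lexx//; lra.
Qed.

Lemma prod_psi0E s (x : 'rV[R]_s) :
  \prod_(j < s) psi0 (x ord0 j) = [forall j, (0 <= x ord0 j <= 1)%R]%:R.
Proof.
case: (boolP [forall _, _]) => [/forallP H|].
  by apply: big1 => j _; rewrite psi0E H.
rewrite negb_forall => /existsP[j /negbTE Hj].
by rewrite (bigD1 j)//= psi0E Hj mul0r.
Qed.

Lemma psi_theta_le s th (x : 'rV[R]_s) :
  `|psi_theta th x| <= \prod_(j < s) psi0 (x ord0 j).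
Proof.
by rewrite /psi_theta normr_prod; apply: ler_prod => j _; rewrite normr_ge0 psi_le_psi0.
Qed.
End Haar.

Section HaarAffine.
Variable R : realType.
Local Notation mu := (@lebesgue_measure R).

Definition cube_center s n (alpha : 'rV[int]_s) : 'rV[R]_s :=
  2 ^- n *: (map_mx (fun z : int => z%:~R) alpha + const_mx 2^-1).

Lemma cubeP s n (alpha : 'rV[int]_s) (x : 'rV[R]_s) :
  cube n alpha x <->
  forall j, 0 <= 2 ^+ n * x ord0 j - (alpha ord0 j)%:~R <= 1.
Proof.
have c0 : (2 ^+ n : R) != 0 by rewrite expf_neq0.
split=> [[y Hy ->] j|H].
  rewrite !mxE -mulrDr mulrA divff// mul1r.
  by have := Hy j; lra.
exists (\row_j (2 ^+ n * x ord0 j - (alpha ord0 j)%:~R - 2^-1)).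
  by move=> j; rewrite mxE; have := H j; lra.
apply/rowP => j; rewrite !mxE.
by apply: (mulfI c0); rewrite -mulrDr mulrA divff// mul1r; lra.
Qed.

(** The term [e * \prod_k psi0] sits inside the same integral so that a pointwise bound on [f] times
    a Haar function, with its error, can be integrated by monotonicity alone. *)
Lemma iint_affine_haar s n (alpha : 'rV[int]_s) (g : 'rV[R]_s) (A e : R) (j : 'I_s) :
  let u (t : 'rV[R]_s) : 'rV[R]_s := 2 ^+ n *: t - map_mx (fun z : int => z%:~R) alpha in
  iint (fun t : 'rV[R]_s =>
    ((A + \sum_k g ord0 k * (t ord0 k - cube_center n alpha ord0 k)) *
       psi_theta (eps j) (u t) + e * \prod_k psi0 (u t ord0 k))%:E) =
  (2 ^- n ^+ s * (e - 2 ^- n * g ord0 j / 4))%:E.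
Proof.
move=> u; have c0 : 0 < (2 ^+ n : R) by rewrite exprn_gt0.
(* The three kinds of terms: [e * prod psi0], the constant [A], and the linear
   terms indexed by the coordinates. *)
pose r : seq (option (option 'I_s)) :=
  None :: Some None :: [seq Some (Some k) | k <- enum 'I_s].
pose co (i : option (option 'I_s)) : R :=
  match i with None => e | Some None => A | Some (Some k) => g ord0 k end.
pose bb (i : option (option 'I_s)) (l : 'I_s) := if i is Some _ then eps j l else false.
pose ww (i : option (option 'I_s)) (l : 'I_s) := if i is Some (Some k) then l == k else false.
pose phi i l := haar_factor (2 ^+ n : R) (alpha ord0 l)%:~R (bb i l) (ww i l).
have uE t l : u t ord0 l = 2 ^+ n * t ord0 l - (alpha ord0 l)%:~R by rewrite !mxE.
have centerE l : cube_center n alpha ord0 l = ((alpha ord0 l)%:~R + 2^-1) / 2 ^+ n.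
  by rewrite !mxE mulrC.
have intphi i l := integral_haar_factor (alpha ord0 l)%:~R (bb i l) (ww i l) c0.
rewrite (_ : (fun t => _) = (fun t : 'rV[R]_s => (\sum_(i <- r) co i *
     \prod_(l < s) phi i l (t ord0 l))%:E)); last first.
  apply/funext => t; congr EFin; rewrite !big_cons big_map /= addrC; congr (_ * _ + _).
    by apply: eq_bigr => l _; rewrite /phi /haar_factor /= mulr1 -uE.
  rewrite mulrDl; congr (_ * _ + _).
    by apply: eq_bigr => l _; rewrite /phi /haar_factor /= mulr1 -uE.
  rewrite -big_enum /= mulr_suml; apply: eq_bigr => k _.
  rewrite -mulrA; congr (_ * _); rewrite /phi /haar_factor big_split /= mulrC.
  congr (_ * _); first by apply: eq_bigr => l _; rewrite -uE.
  rewrite (bigD1 k)//= eqxx -centerE big1 ?mulr1// => l /negbTE lk.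
  by rewrite lk.
rewrite iint_sum_prod; last by move=> i l; have [] := intphi i l.
congr EFin; rewrite !big_cons big_map /=.
under eq_bigr do rewrite (intphi _ _).2 /=.
rewrite prodr_const card_ord.
(* The [j]-th factor is [psi1], of mean zero unless weighted by the [j]-th coordinate. So the
   constant and all linear terms with [k != j] drop out. *)
have int0 i : ww (Some i) j = false ->
    \prod_(l < s) (\int[mu]_t phi (Some i) l t)%R = 0.
  by move=> H; rewrite (bigD1 j)//= (intphi _ _).2 H /= /eps eqxx mul0r.
rewrite [X in A * X]int0 ?mulr0 ?add0r//.
rewrite big_enum /= (bigD1 j)//= [X in _ + (_ + X)]big1 ?addr0; last first.
  by move=> k kj; rewrite int0 ?mulr0//=; rewrite eq_sym; apply/negbTE.
rewrite (bigD1 j)//= (intphi _ _).2 /= /eps eqxx.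
rewrite (eq_bigr (fun=> 2 ^- n)); last first.
  by move=> l /negbTE lj; rewrite (intphi _ _).2 /= /eps lj.
have -> : \prod_(i < s | i != j) (2 ^- n : R) = 2 ^- n ^+ s.-1.
  by rewrite prodr_const cardC1 card_ord.
rewrite -[in 2 ^- n ^+ s](prednK (leq_ltn_trans (leq0n j) (ltn_ord j))) exprS.
by ring.
Qed.


End HaarAffine.

(** * From affine approximation to Haar coefficients *)

Section Coefficients.
Variable R : realType.

(** The integral of [f] against the Haar function is trapped between the values of
    [iint_affine_haar] at [e] and [- e]. Multiplying by [- 2 ^+ n.+2] turns the main part
    [- h^(s+1) g_j / 4], with [h = 2^-n], into [h^s g_j]. *)
Lemma dhat_approx s n (alpha : 'rV[int]_s) (f : 'rV[R]_s -> R) (g : 'rV[R]_s) (A e : R) :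
  (forall t, cube n alpha t ->
    `|f t - (A + \sum_k g ord0 k * (t ord0 k - cube_center R n alpha ord0 k))| <= e) ->
  forall j, `|dhat n alpha f ord0 j - 2 ^- n ^+ s * g ord0 j|
    <= 4 * 2 ^+ n * (e * 2 ^- n ^+ s).
Proof.
move=> He j.
pose u (t : 'rV[R]_s) : 'rV[R]_s := 2 ^+ n *: t - map_mx (fun z : int => z%:~R) alpha.
pose L (t : 'rV[R]_s) := A + \sum_k g ord0 k * (t ord0 k - cube_center R n alpha ord0 k).
pose P (t : 'rV[R]_s) := \prod_k psi0 (u t ord0 k).
have fL t : `|(f t - L t) * psi_theta (eps j) (u t)| <= e * P t.
  rewrite normrM; have := psi_theta_le (eps j) (u t); rewrite -/(P t).
  rewrite {1 2}/P prod_psi0E; case: (boolP [forall _, _]) => [/forallP H|_].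
    move=> h; apply: ler_pM => //; apply: He; apply/cubeP => k.
    by have := H k; rewrite !mxE.
  by rewrite normr_le0 => /eqP ->; rewrite normr0 !mulr0.
have up : (iint (fun t => (f t * psi_theta (eps j) (u t))%:E) <=
    (2 ^- n ^+ s * (e - 2 ^- n * g ord0 j / 4))%:E)%E.
  rewrite -(iint_affine_haar n alpha g A e j); apply: le_iint => t.
  by rewrite lee_fin -/(P t) -/(L t) -lerBlDl -mulrBl; apply: le_trans (fL t); exact: ler_norm.
have dn : ((2 ^- n ^+ s * (- e - 2 ^- n * g ord0 j / 4))%:E <=
    iint (fun t => (f t * psi_theta (eps j) (u t))%:E))%E.
  rewrite -(iint_affine_haar n alpha g A (- e) j); apply: le_iint => t.
  rewrite lee_fin -/(P t) -/(L t) mulNr lerBlDl -lerBlDr -mulrBl.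
  by apply: le_trans (fL t); rewrite -normrN -mulNr opprB; exact: ler_norm.
rewrite mxE /haar_coef -/u.
(* Both bounds are real, so the integral is finite and [fine] returns its true value. *)
case: (iint _) up dn => [v||]; rewrite ?leNye_eq ?leye_eq ?lee_fin//=.
move=> up dn; rewrite mulNr [X in - X]mulrA -powRD; last by rewrite pnatr_eq0 implybT.
(* The normalizations of [dhat] and [haar_coef] combine to a power of 2 free of [s]. *)
have -> : n%:R * (1 - s%:R / 2) + 2 + n%:R * s%:R / 2 = n.+2%:R :> R.
  by rewrite -[n.+2]addn2 natrD; field.
rewrite powR_mulrn//.
have c0 : 0 < (2 ^+ n : R) by rewrite exprn_gt0.
have Sg : 2 ^- n ^+ s * g ord0 j = 4 * 2 ^+ n * (2 ^- n ^+ s * (2 ^- n * g ord0 j / 4)).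
  by field; rewrite gt_eqF.
have -> : 2 ^+ n.+2 = 4 * 2 ^+ n :> R by rewrite !exprS; ring.
have c4 : 0 <= 4 * 2 ^+ n :> R by rewrite mulr_ge0// ltW.
rewrite Sg -opprD normrN -mulrDr normrM ger0_norm// ler_wpM2l//.
by rewrite ler_norml; lra.
Qed.
End Coefficients.

(** * Taylor estimates on one cube *)

Section MeanValue.
Variable R : realType.

Lemma is_derive_line s (f : 'rV[R]_s -> R) (x v : 'rV[R]_s) (t : R) :
  derivable f (x + t *: v) v ->
  is_derive t (1 : R) (fun t => f (x + t *: v)) ('D_v f (x + t *: v)).
Proof.
move=> df.
have E : (fun h : R => h^-1 *:
    (((fun t => f (x + t *: v)) \o shift t) (h *: (1 : R)) - f (x + t *: v))) =
  (fun h : R => h^-1 *: ((f \o shift (x + t *: v)) (h *: v) - f (x + t *: v))).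
  apply/funext => h /=; congr (_ *: (f _ - _)).
  by rewrite /GRing.scale /= mulr1 addrCA -scalerDl.
by split; rewrite /derivable /derive E.
Qed.

Lemma partial_mvt s (f : 'rV[R]_s -> R) k (x : 'rV[R]_s) (d : R) :
  (forall y, derivable f y (unitv R k)) ->
  exists2 e : R, Num.min 0 d <= e <= Num.max 0 d &
    f (x + d *: unitv R k) - f x = partial k f (x + e *: unitv R k) * d.
Proof.
move=> df; set v := unitv R k.
have D t : is_derive t (1 : R) (fun t => f (x + t *: v)) ('D_v f (x + t *: v)).
  exact/is_derive_line/df.
have C (i : interval R) : {within [set` i], continuous (fun t => f (x + t *: v))}.
  by apply: derivable_within_continuous => t _; have [] := D t.
have f0 : f x = f (x + (0:R) *: v) by rewrite scale0r addr0.
have [d0|d0] := leP 0 d.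
  have [e e0d E] := MVT_segment d0 (fun t _ => D t) (C _).
  exists e; first by rewrite !(itvP e0d).
  by rewrite f0 E subr0.
have [e e0d E] := MVT_segment (ltW d0) (fun t _ => D t) (C _).
exists e; first by rewrite !(itvP e0d).
by apply/eqP; rewrite -eqr_opp opprB f0 E sub0r mulrN.
Qed.

Lemma box_mvt s (f : 'rV[R]_s -> R) (l u x t : 'rV[R]_s) :
  (forall k y, derivable f y (unitv R k)) ->
  (forall j, l ord0 j <= x ord0 j <= u ord0 j) ->
  (forall j, l ord0 j <= t ord0 j <= u ord0 j) ->
  exists2 xi : 'I_s -> 'rV[R]_s,
    (forall k j, l ord0 j <= xi k ord0 j <= u ord0 j) &
    f t - f x = \sum_k partial k f (xi k) * (t ord0 k - x ord0 k).
Proof.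
move=> df bx bt.
(* Move from [x] to [t] one coordinate at a time: only partial derivatives are
   available, and every intermediate point stays in the box. *)
pose z (m : nat) : 'rV[R]_s := \row_j (if (j < m)%N then t ord0 j else x ord0 j).
have step (k : 'I_s) : exists y : 'rV[R]_s,
    (forall j, l ord0 j <= y ord0 j <= u ord0 j) /\
    f (z k.+1) - f (z k) = partial k f y * (t ord0 k - x ord0 k).
  have [e He E] := partial_mvt (z k) (t ord0 k - x ord0 k) (df k).
  exists (z k + e *: unitv R k); split.
    move=> j; rewrite !mxE.
    have [->|jk] := eqVneq j k.
      rewrite ltnn mulr1; move: He (bx k) (bt k).
      by rewrite /Num.min /Num.max; case: ltP => ?; lra.
    by rewrite mulr0 addr0; case: ifP.
  rewrite -E; congr (f _ - _); apply/rowP => j; rewrite !mxE ltnS leq_eqVlt.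
  have [->|jk] := eqVneq j k; first by rewrite eqxx ltnn /=; ring.
  by rewrite (inj_eq val_inj) (negbTE jk) /= mulr0 addr0.
have [xi Hxi] := choice step.
exists xi; first by move=> k; have [] := Hxi k.
under eq_bigr do rewrite -(Hxi _).2.
have -> : t = z s by apply/rowP => j; rewrite mxE ltn_ord.
have -> : x = z 0 by apply/rowP => j; rewrite mxE.
by rewrite -(telescope_sumr (fun m => f (z m)) (leq0n s)) big_mkord.
Qed.

End MeanValue.

(** * Norm comparisons and oscillation on a cube *)

Section CubeEstimates.
Variable R : realType.

Lemma ler_sum_card s (F : 'I_s -> R) (c : R) :
  (forall k, F k <= c) -> \sum_k F k <= s%:R * c.
Proof.
move=> Fc; rewrite mulr_natl -[X in _ *+ X](card_ord s) -sumr_const.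
by apply: ler_sum => k _; exact: Fc.
Qed.

(** After squaring, the two sides are compared coordinate by coordinate: with [w = u - v], use
    [|v_j| <= norm2 v] in the cross term and [|w_j| <= \sum_i |w_i|] in the square of [w_j]. *)
Lemma norm2_le_add_l1 s (u v : 'rV[R]_s) :
  norm2 u <= norm2 v + \sum_j `|u ord0 j - v ord0 j|.
Proof.
have n0 (w : 'rV[R]_s) : 0 <= norm2 w by exact: sqrtr_ge0.
have S0 : 0 <= \sum_j `|u ord0 j - v ord0 j| by apply: sumr_ge0.
rewrite -(@ler_pXn2r _ 2)// ?nnegrE ?addr_ge0//.
have sq (w : 'rV[R]_s) : norm2 w ^+ 2 = \sum_j (w ord0 j) ^+ 2.
  by rewrite sqr_sqrtr// sumr_ge0// => j _; exact: sqr_ge0.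
have vj j : `|v ord0 j| <= norm2 v.
  rewrite -(@ler_pXn2r _ 2)// ?nnegrE// sq real_normK ?num_real// (bigD1 j)//=.
  by rewrite lerDl sumr_ge0// => k _; exact: sqr_ge0.
rewrite sqrrD !sq -mulr_natl mulr_sumr mulr_sumr expr2 mulr_suml -!big_split /=.
apply: ler_sum => j _.
set w := u ord0 j - v ord0 j.
have -> : u ord0 j = v ord0 j + w by rewrite /w; ring.
rewrite sqrrD -mulr_natl; apply: lerD; first apply: lerD => //.
  rewrite ler_pM2l// (le_trans (ler_norm _))// normrM ler_wpM2r//.
rewrite -[w ^+ 2]real_normK ?num_real// expr2 ler_wpM2l// (bigD1 j)//= lerDl.
exact: sumr_ge0.
Qed.

Lemma norm2Z s (a : R) (v : 'rV[R]_s) : 0 <= a -> norm2 (a *: v) = a * norm2 v.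
Proof.
move=> a0; rewrite /norm2 (eq_bigr (fun j => a ^+ 2 * (v ord0 j) ^+ 2)).
  by rewrite -mulr_sumr sqrtrM ?sqr_ge0// sqrtr_sqr ger0_norm.
by move=> j _; rewrite mxE exprMn.
Qed.

Lemma dist_norm2_le_l1 s (u v : 'rV[R]_s) :
  `|norm2 u - norm2 v| <= \sum_j `|u ord0 j - v ord0 j|.
Proof.
rewrite ler_norml lerBlDl norm2_le_add_l1 andbT -subr_ge0 opprK addrAC subr_ge0.
apply: le_trans (norm2_le_add_l1 v u) _; rewrite lerD2l.
by apply: ler_sum => j _; rewrite distrC.
Qed.

Definition grad s (f : 'rV[R]_s -> R) (x : 'rV[R]_s) : 'rV[R]_s :=
  \row_j partial j f x.

Lemma norm2_grad s (f : 'rV[R]_s -> R) x : norm2 (grad f x) = grad_norm f x.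
Proof.
by rewrite /norm2 /grad_norm; congr Num.sqrt; apply: eq_bigr => j _; rewrite mxE.
Qed.

Lemma partial2_le_hess s (f : 'rV[R]_s -> R) j k x :
  `|partial k (partial j f) x| <= hess_frob f x.
Proof.
pose q j k := partial k (partial j f) x ^+ 2.
have q0 i l : 0 <= q i l by exact: sqr_ge0.
have jk : q j k <= \sum_l q j l by rewrite (bigD1 k)//= lerDl; apply: sumr_ge0 => l _; exact: q0.
have jj : \sum_l q j l <= \sum_i \sum_l q i l.
  rewrite [leRHS](bigD1 j)//= lerDl; apply: sumr_ge0 => i _.
  by apply: sumr_ge0 => l _; exact: q0.
by rewrite -(sqrtr_sqr (partial k _ x)); exact/ler_wsqrtr/(le_trans jk jj).
Qed.

Lemma cube_box s n (alpha : 'rV[int]_s) (x : 'rV[R]_s) :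
  cube n alpha x <-> forall j, 2 ^- n * (alpha ord0 j)%:~R <= x ord0 j <=
    2 ^- n * ((alpha ord0 j)%:~R + 1).
Proof.
have c0 : 0 < (2 ^+ n : R) by rewrite exprn_gt0.
have E j : (2 ^- n * (alpha ord0 j)%:~R <= x ord0 j <= 2 ^- n * ((alpha ord0 j)%:~R + 1)) =
    (0 <= 2 ^+ n * x ord0 j - (alpha ord0 j)%:~R <= 1).
  by rewrite ler_pdivrMl// ler_pdivlMl// subr_ge0 lerBlDl.
by rewrite cubeP; split=> H j; rewrite ?E// -E.
Qed.

Lemma cube_center_in s n (alpha : 'rV[int]_s) : cube n alpha (cube_center R n alpha).
Proof.
exists 0; last by rewrite scaler0 addr0.
by move=> j; rewrite mxE oppr_le0 invr_ge0 ler0n.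
Qed.

Section OneCube.
Variables (s n : nat) (alpha : 'rV[int]_s).
Local Notation h := (2 ^- n : R).

Lemma cube_mvt (g : 'rV[R]_s -> R) x t :
  (forall k y, derivable g y (unitv R k)) -> cube n alpha x -> cube n alpha t ->
  exists2 xi : 'I_s -> 'rV[R]_s, (forall k, cube n alpha (xi k)) &
    g t - g x = \sum_k partial k g (xi k) * (t ord0 k - x ord0 k).
Proof.
move=> dg /cube_box cx /cube_box ct.
pose l : 'rV[R]_s := \row_j (h * (alpha ord0 j)%:~R).
pose u : 'rV[R]_s := \row_j (h * ((alpha ord0 j)%:~R + 1)).
have lu (y : 'rV[R]_s) j : (l ord0 j <= y ord0 j <= u ord0 j) =
  (h * (alpha ord0 j)%:~R <= y ord0 j <= h * ((alpha ord0 j)%:~R + 1)) by rewrite !mxE.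
have [||xi cxi E] := @box_mvt R s g l u x t dg; [by move=> j; rewrite lu|by move=> j; rewrite lu|].
by exists xi => // k; apply/cube_box => j; rewrite -lu.
Qed.

Lemma cube_dist x t k : cube n alpha x -> cube n alpha t ->
  `|t ord0 k - x ord0 k| <= h :> R.
Proof.
move=> /cube_box/(_ k) cx /cube_box/(_ k) ct.
by move: cx ct; rewrite mulrDr mulr1 ler_norml; lra.
Qed.

Variables (f : 'rV[R]_s -> R) (M : R).
Hypothesis hf : C2 f.
Hypothesis hM : forall x, cube n alpha x -> hess_frob f x <= M.

Lemma partial_cube_dist j x t : cube n alpha x -> cube n alpha t ->
  `|partial j f t - partial j f x| <= s%:R * (M * h).
Proof.
move=> cx ct; case: hf => _ [_ [_ [d2 _]]].
have [xi cxi ->] := cube_mvt (d2 j) cx ct.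
apply: le_trans (ler_norm_sum _ _ _) _.
apply: ler_sum_card => k.
rewrite normrM ler_pM ?cube_dist//.
by apply: le_trans (partial2_le_hess _ _ _ _) (hM (cxi k)).
Qed.

(** The mean value formula gives partial derivatives at points [xi k] of the cube; moving each to
    [x] costs [partial_cube_dist], which supplies the second factor [h]. *)
Lemma taylor_cube x t : cube n alpha x -> cube n alpha t ->
  `|f t - (f x + \sum_k grad f x ord0 k * (t ord0 k - x ord0 k))| <=
    s%:R * (s%:R * (M * h) * h).
Proof.
move=> cx ct; case: hf => _ [d1 _].
have [xi cxi E] := cube_mvt d1 cx ct.
rewrite opprD addrA E -sumrB.
apply: le_trans (ler_norm_sum _ _ _) _.
apply: ler_sum_card => k.
rewrite mxE -mulrBl normrM ler_pM ?cube_dist//.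
exact: partial_cube_dist.
Qed.

Lemma grad_norm_cube_dist x t : cube n alpha x -> cube n alpha t ->
  `|grad_norm f t - grad_norm f x| <= s%:R * (s%:R * (M * h)).
Proof.
move=> cx ct; rewrite -!norm2_grad.
apply: le_trans (dist_norm2_le_l1 _ _) _.
apply: ler_sum_card => k.
by rewrite !mxE; exact: partial_cube_dist.
Qed.

Lemma dhat_cube_dist :
  `|norm2 (dhat n alpha f) - h ^+ s * grad_norm f (cube_center R n alpha)| <=
     4 * s%:R ^+ 3 * (h * (h ^+ s * M)).
Proof.
have c0 : (2 ^+ n : R) != 0 by rewrite expf_neq0.
have hs0 : 0 <= h ^+ s by rewrite exprn_ge0// invr_ge0 exprn_ge0.
rewrite -norm2_grad -norm2Z//.
apply: le_trans (dist_norm2_le_l1 _ _) _.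
(* One [s] sums the coordinates and two come from [taylor_cube]; the [4 * 2 ^+ n] of [dhat_approx]
   cancels one of the two factors [h] of the Taylor error. *)
have -> : 4 * s%:R ^+ 3 * (h * (h ^+ s * M)) =
   s%:R * (4 * 2 ^+ n * (s%:R * (s%:R * (M * h) * h) * h ^+ s)).
  by field.
apply: ler_sum_card => k.
rewrite [X in _ - X]mxE.
apply: (dhat_approx (A := f (cube_center R n alpha))) => t ct.
by apply: taylor_cube => //; exact: cube_center_in.
Qed.
End OneCube.
End CubeEstimates.

(** * Boundedness of the Hessian sums *)

Section HessianSums.
Variable R : realType.

Lemma iint_ge0 s (g : 'rV[R]_s -> \bar R) : (forall x, 0 <= g x)%E -> (0 <= iint g)%E.
Proof.
elim: s g => [|s IH] g g0 /=; first exact: g0.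
by apply: integral_ge0 => t _; exact: IH.
Qed.

Lemma esum_ge_term (T : choiceType) (I : set T) (a : T -> \bar R) i :
  I i -> (a i <= \esum_(j in I) a j)%E.
Proof.
move=> Ii; apply: esum_ge; exists [set i]; last by rewrite fsbig_set1.
by split => // j ->.
Qed.

Lemma floor_mx_cube s n (x : 'rV[R]_s) : cube n (floor_mx (2 ^+ n) x) x.
Proof.
apply/cubeP => j; rewrite mxE.
by have := floor_itv (2 ^+ n * x ord0 j); rewrite intrD; lra.
Qed.

(** With fine index [a], coarse index [b] and [d = n - m], the floor inequalities and integrality
    give [2^d b <= a] and [a + 1 <= 2^d (b + 1)], so the closed cubes are nested. *)
Lemma cube_floor_mx_sub s n m (x : 'rV[R]_s) : (m <= n)%N ->
  cube (R := R) n (floor_mx (2 ^+ n) x) `<=` cube m (floor_mx (2 ^+ m) x).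
Proof.
move=> mn y /cubeP Hy; apply/cubeP => j; move: (Hy j); rewrite !mxE.
rewrite -(subnK mn) exprD; set d := (n - m)%N.
have d0 : 0 < (2 ^+ d : R) by rewrite exprn_gt0.
set a := Num.floor (2 ^+ d * _ * _); set b := Num.floor _.
have /andP[b1 b2] := floor_itv (2 ^+ m * x ord0 j); rewrite -/b in b1 b2.
have /andP[a1 a2] := floor_itv (2 ^+ d * 2 ^+ m * x ord0 j); rewrite -/a in a1 a2.
have dE : ((2 ^+ d : int)%:~R : R) = 2 ^+ d by rewrite rmorphXn.
have ba : 2 ^+ d * b%:~R <= a%:~R :> R.
  by rewrite -dE -intrM ler_int floor_ge_int intrM dE -mulrA ler_pM2l.
have ab : a%:~R + 1 <= 2 ^+ d * (b + 1)%:~R :> R.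
  rewrite -dE -intrM -intrD1 ler_int lezD1 floor_lt_int intrM dE -mulrA.
  by rewrite ltr_pM2l.
move=> /andP[y1 y2]; rewrite intrD in ab; apply/andP; split.
  by rewrite -(ler_pM2l d0) mulr0 mulrBr mulrA; lra.
by rewrite -(ler_pM2l d0) mulrBr mulrA; lra.
Qed.

(** Integer division by [2 ^+ (m - n)] sends a fine index to its parent. Naming the parent by a
    function assigns each fine cube to exactly one coarse cube, as the summation in [H_coarse]
    requires. *)
Lemma cube_refine s n m (alpha : 'rV[int]_s) (x : 'rV[R]_s) : (n <= m)%N ->
  cube n alpha x ->
  exists2 beta : 'rV[int]_s,
    map_mx (fun b : int => (b %/ 2 ^+ (m - n))%Z) beta = alpha & cube m beta x.
Proof.
move=> nm /cubeP Hx; set d := (m - n)%N.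
have d0 : 0 < (2 ^+ d : R) by rewrite exprn_gt0.
have d0' : 0 < (2 ^+ d : int) by rewrite exprn_gt0.
have dE : ((2 ^+ d : int)%:~R : R) = 2 ^+ d by rewrite rmorphXn.
have step (j : 'I_s) : exists b : int, (b %/ 2 ^+ d)%Z = alpha ord0 j /\
     0 <= 2 ^+ m * x ord0 j - b%:~R <= 1.
  have := Hx j; set y := 2 ^+ n * _; set a := alpha ord0 j => /andP[y1 y2].
  have -> : 2 ^+ m * x ord0 j = 2 ^+ d * y by rewrite /y mulrA -exprD subnK.
  have Y1 : 2 ^+ d * a%:~R <= 2 ^+ d * y by rewrite ler_pM2l//; lra.
  have Y2 : 2 ^+ d * y <= 2 ^+ d * (a%:~R + 1) by rewrite ler_pM2l//; lra.
  have dv (b : int) : a * 2 ^+ d <= b -> b < (a + 1) * 2 ^+ d -> (b %/ 2 ^+ d)%Z = a.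
    move=> b1 b2; apply/eqP; rewrite eq_le -[X in _ <= X]/a.
    by rewrite lez_divRL// b1 andbT -ltzD1 ltz_divLR.
  have /andP[f1 f2] := floor_itv (2 ^+ d * y).
  have fa : a * 2 ^+ d <= Num.floor (2 ^+ d * y).
    by rewrite floor_ge_int intrM dE mulrC.
  have [fl|fl] := ltP (Num.floor (2 ^+ d * y)) ((a + 1) * 2 ^+ d).
    exists (Num.floor (2 ^+ d * y)); split; first exact: dv.
    by rewrite intrD in f2; lra.
  (* [x] lies on the upper face of the coarse cube. *)
  exists ((a + 1) * 2 ^+ d - 1); split.
    apply: dv; last by rewrite ltrBlDr ltrDl.
    by rewrite mulrDl mul1r lerBrDr lerD2l -gtz0_ge1.
  move: fl; rewrite floor_ge_int => fl.
  by move: fl; rewrite intrB !intrM intrD dE; lra.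
have [b Hb] := choice step.
exists (\row_j b j); first by apply/rowP => j; rewrite !mxE (Hb j).1.
by apply/cubeP => j; rewrite mxE (Hb j).2.
Qed.

Section Fixed.
Variables (s : nat) (f : 'rV[R]_s -> R).

Definition hess_sup n alpha : \bar R :=
  ereal_sup [set (hess_frob f x)%:E | x in cube n alpha].

Lemma hess_frob_le_sup n alpha x : cube n alpha x ->
  ((hess_frob f x)%:E <= hess_sup n alpha)%E.
Proof. by move=> cx; apply: ereal_sup_ubound; exists x. Qed.

Lemma hess_sup_ge0 n alpha : (0 <= hess_sup n alpha)%E.
Proof.
apply: le_trans (hess_frob_le_sup (cube_center_in R n alpha)).
by rewrite lee_fin sqrtr_ge0.
Qed.

Lemma H_esum n : H n f = (\esum_(alpha in [set: 'rV[int]_s])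
  ((2 ^- n) ^+ s)%:E * hess_sup n alpha)%E.
Proof. by apply: eq_esum => alpha _; rewrite exprM exprVn. Qed.

(** As integrals of step functions, the sums at two levels can be compared pointwise. *)
Lemma H_iint n : H n f = iint (fun x => hess_sup n (floor_mx (2 ^+ n) x)).
Proof.
rewrite H_esum iint_floor//; last exact: hess_sup_ge0.
Qed.

Lemma H_ge0 n : (0 <= H n f)%E.
Proof. by rewrite H_iint; apply: iint_ge0 => x; exact: hess_sup_ge0. Qed.

Lemma H_nonincreasing n m : (m <= n)%N -> (H n f <= H m f)%E.
Proof.
move=> mn; rewrite !H_iint; apply: le_iint => x.
apply: le_ereal_sup => _ [y cy <-]; exists y => //.
exact: (cube_floor_mx_sub mn cy).
Qed.

(** A supremum over a coarse cube is at most the sum of the suprema over its children, and each fine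
    cube has one parent. The factor [2 ^+ (m * s)] cancels the fine weight, and the coarse weight is
    at most 1. *)
Lemma H_coarse n m : (n <= m)%N -> (H n f <= (2 ^+ (m * s))%:E * H m f)%E.
Proof.
move=> nm.
pose fib alpha : set 'rV[int]_s :=
  [set beta | map_mx (fun b : int => (b %/ 2 ^+ (m - n))%Z) beta = alpha].
have c0 k : (0 <= ((2 ^- k) ^+ s : R))%R by rewrite exprn_ge0// invr_ge0 exprn_ge0.
have sup_fib alpha : (hess_sup n alpha <= \esum_(beta in fib alpha) hess_sup m beta)%E.
  apply: ge_ereal_sup => _ [x cx <-].
  have [beta fb cb] := cube_refine nm cx.
  exact: le_trans (hess_frob_le_sup cb) (esum_ge_term _ fb).
have -> : ((2 ^+ (m * s))%:E * H m f =
    \esum_(alpha in setT) \esum_(beta in fib alpha) hess_sup m beta)%E.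
  rewrite esum_esum; last by move=> *; exact: hess_sup_ge0.
  pose e (beta : 'rV[int]_s) :=
    (map_mx (fun b : int => (b %/ 2 ^+ (m - n))%Z) beta, beta).
  rewrite (@reindex_esum _ _ _ setT _ e); last first.
    split => [//|b b' _ _ [] //|[a b] [_ /= <-]]; by exists b.
  rewrite H_esum -ge0_esumZl ?exprn_gt0//; last first.
    by move=> beta; rewrite mule_ge0 ?hess_sup_ge0// lee_fin.
  apply: eq_esum => beta _; rewrite muleA -EFinM exprVn -exprM divff ?mul1e//.
rewrite H_esum; apply: le_esum => alpha _.
apply: le_trans (sup_fib alpha); rewrite -[leRHS]mul1e lee_wpmul2r ?hess_sup_ge0//.
by rewrite lee_fin exprVn invf_le1 ?exprn_gt0// exprn_ege1// exprn_ege1// ler1n.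
Qed.

Lemma H_bounded m : (H m f < +oo)%E -> exists2 K : R, 0 <= K & forall n, (H n f <= K%:E)%E.
Proof.
move=> Hm; have Hf : H m f \is a fin_num by rewrite ge0_fin_numE// H_ge0.
have H0 : 0 <= fine (H m f) by rewrite fine_ge0// H_ge0.
have c1 : 1 <= (2 ^+ (m * s) : R) by rewrite exprn_ege1// ler1n.
exists (2 ^+ (m * s) * fine (H m f)); first by rewrite mulr_ge0// exprn_ge0.
move=> n; rewrite EFinM fineK//; have [nm|mn] := leqP n m; first exact: H_coarse.
apply: le_trans (H_nonincreasing (ltnW mn)) _.
by rewrite -[leLHS]mul1e lee_wpmul2r ?H_ge0// lee_fin.
Qed.
End Fixed.
End HessianSums.

(** * Comparison with the total variation *)

Section Main.
Variables (R : realType) (s : nat) (f : 'rV[R]_s -> R).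
Hypothesis hf : C2 f.

(** A dyadic cube containing [x0] and of side below the radius [e] lies in the neighbourhood; [c]
    times the indicator of that cube is a step function below [g] with positive integral. *)
Lemma iint_gt0 (g : 'rV[R]_s -> R) (x0 : 'rV[R]_s) (c : R) : 0 < c ->
  (forall x, 0 <= g x) -> (\forall x \near x0, c <= g x) ->
  (0 < iint (fun x => (g x)%:E))%E.
Proof.
move=> c0 g0 /nbhs_ballP[/= e e0 He].
have [N _ HN] := near_infty_natSinv_expn_lt (PosNum e0).
have {HN} HN : 2 ^- N < e by have := HN N (leqnn N); rewrite /= mul1r.
have p0 : 0 < (2 ^+ N : R) by rewrite exprn_gt0.
pose F a : \bar R := if a == floor_mx (2 ^+ N) x0 then c%:E else 0%E.
have F0 a : (0 <= F a)%E by rewrite /F; case: ifP => // _; rewrite lee_fin ltW.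
apply: (@lt_le_trans _ _ (iint (fun x => F (floor_mx (2 ^+ N) x)))); last first.
  apply: le_iint => x; rewrite /F; case: ifPn => [/eqP xx0|_]; rewrite lee_fin//.
  apply: He; split => // i j; rewrite ord1 /ball /=.
  apply: le_lt_trans HN; apply: (@cube_dist _ _ _ (floor_mx (2 ^+ N) x0)).
    by rewrite -xx0; exact: floor_mx_cube.
  exact: floor_mx_cube.
rewrite iint_floor//.
apply: (@lt_le_trans _ _ ((2 ^+ N)^-1 ^+ s * c)%:E).
  by rewrite lte_fin mulr_gt0// exprn_gt0// invr_gt0.
have := @esum_ge_term R _ setT (fun a => ((2 ^+ N)^-1 ^+ s)%:E * F a)%E (floor_mx (2 ^+ N) x0) I.
by rewrite /F eqxx EFinM.
Qed.

(** If some second partial is nonzero at [x], continuity keeps it above half its absolute value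
    nearby, and [iint_gt0] makes the integral positive. *)
Lemma hess_int0 : hess_int f = 0%E -> forall x, hess_frob f x = 0.
Proof.
move=> h0 x; apply/eqP/negPn/negP => hx.
have [j [k jk]] : exists j k, partial k (partial j f) x != 0.
  apply/not_existsP => H; move/eqP: hx; apply.
  rewrite /hess_frob big1 ?sqrtr0// => j _; rewrite big1// => k _.
  have /forallNP/(_ k)/negP := H j.
  by rewrite negbK => /eqP ->; rewrite expr0n.
have c0 : 0 < `|partial k (partial j f) x| by rewrite normr_gt0.
have c20 : 0 < `|partial k (partial j f) x| / 2 by rewrite divr_gt0.
have [_ [_ [_ [_ /(_ j k x) cont]]]] := hf.
have : (0 < hess_int f)%E.
  apply: (iint_gt0 (x0 := x) c20) => [y|]; first exact: sqrtr_ge0.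
  near=> y; apply: le_trans (partial2_le_hess f j k y).
  have : `|partial k (partial j f) x - partial k (partial j f) y| <
      `|partial k (partial j f) x| / 2.
    by near: y; move/cvgr_dist_lt : cont; apply.
  have := ler_distD (partial k (partial j f) y) (partial k (partial j f) x) 0.
  move: (partial k (partial j f) x) (partial k (partial j f) y) => u v.
  by rewrite !subr0; lra.
by rewrite h0 ltxx.
Unshelve. all: by end_near. Qed.

Lemma hess_int0_H n : hess_int f = 0%E -> H n f = 0%E.
Proof.
move=> h0; rewrite H_esum; apply: esum1 => a _.
suff -> : hess_sup f n a = 0%E by rewrite mule0.
apply/eqP; rewrite eq_le hess_sup_ge0 andbT; apply: ge_ereal_sup => _ [x _ <-].
by rewrite hess_int0.
Qed.

(** * Error estimates at a fixed level *)

Section Level.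
Variable n : nat.
Hypothesis Hn : (H n f < +oo)%E.
Local Notation h := (2 ^- n : R).

Let h0 : 0 < h. Proof. by rewrite invr_gt0 exprn_gt0. Qed.
Let hs0 : 0 < h ^+ s. Proof. by rewrite exprn_gt0. Qed.

Let M a := fine (hess_sup f n a).

(** The weight [h ^+ s] is positive, so a single infinite supremum would make [H n f] infinite. *)
Let hess_sup_fin a : hess_sup f n a = (M a)%:E.
Proof.
rewrite fineK// ge0_fin_numE ?hess_sup_ge0//.
have : ((h ^+ s)%:E * hess_sup f n a < +oo)%E.
  apply: le_lt_trans Hn; rewrite H_esum.
  exact: (@esum_ge_term R _ setT (fun a => (h ^+ s)%:E * hess_sup f n a)%E).
by case: (hess_sup f n a) => [r _|/=|]; rewrite ?ltry// gt0_muley ?lte_fin.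
Qed.

Let M_ge0 a : 0 <= M a.
Proof. by rewrite fine_ge0// hess_sup_ge0. Qed.

Let hess_le_M a x : cube n a x -> hess_frob f x <= M a.
Proof. by move=> cx; rewrite -lee_fin -hess_sup_fin; exact: hess_frob_le_sup. Qed.

Let esumM (c : R) : 0 <= c ->
  (\esum_(a in [set: 'rV[int]_s]) (c * (h * (h ^+ s * M a)))%:E = (c * h)%:E * H n f)%E.
Proof.
rewrite le_eqVlt => /predU1P[<-|c0].
  by rewrite mul0r mul0e; apply: esum1 => a _; rewrite mul0r.
rewrite H_esum -ge0_esumZl ?mulr_gt0//.
  by apply: eq_esum => a _; rewrite hess_sup_fin -!EFinM !mulrA.
by move=> a; rewrite mule_ge0 ?hess_sup_ge0// lee_fin ltW.
Qed.

(** The first summand pays for the Haar coefficients ([dhat_cube_dist]), the second for the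
    oscillation of the gradient norm ([grad_norm_cube_dist]). *)
Let C : R := 4 * s%:R ^+ 3 + s%:R ^+ 2.
Let G a := grad_norm f (cube_center R n a).
Let q a := s%:R * (s%:R * (M a * h)).

Let G_ge0 a : 0 <= G a. Proof. exact: sqrtr_ge0. Qed.
Let q_ge0 a : 0 <= q a.
Proof. by rewrite !mulr_ge0// ltW. Qed.
Let C_ge0 : 0 <= C.
Proof. by rewrite addr_ge0// mulr_ge0// exprn_ge0. Qed.
Let err_ge0 a : 0 <= C * (h * (h ^+ s * M a)).
Proof. by rewrite !mulr_ge0// ltW. Qed.

Let gradG x : `|grad_norm f x - G (floor_mx (2 ^+ n) x)| <= q (floor_mx (2 ^+ n) x).
Proof.
apply: grad_norm_cube_dist => //; [exact: hess_le_M|exact: cube_center_in|exact: floor_mx_cube].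
Qed.

Let dhatG a : `|norm2 (dhat n a f) - h ^+ s * G a| + h ^+ s * q a <= C * (h * (h ^+ s * M a)).
Proof.
rewrite /C [leRHS]mulrDl; apply: lerD; first exact: dhat_cube_dist hf (@hess_le_M a).
by rewrite le_eqVlt; apply/orP; left; apply/eqP; rewrite /q; ring.
Qed.

(** The step function [G + q] dominates the gradient norm, and its integral is a sum over cubes that
    [dhatG] bounds term by term. *)
Lemma TV_le_sum_dhat : (TV f <= sum_dhat n f + (C * h)%:E * H n f)%E.
Proof.
apply: (@le_trans _ _ (iint (fun x => (G (floor_mx (2 ^+ n) x) + q (floor_mx (2 ^+ n) x))%:E))).
  apply: le_iint => x; rewrite lee_fin -lerBlDl.
  exact: le_trans (ler_norm _) (gradG x).
rewrite (@iint_floor _ _ _ (fun a => (G a + q a)%:E)) ?exprn_gt0//; last first.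
  by move=> a; rewrite lee_fin addr_ge0.
rewrite -esumM// -esumD; first last.
- by move=> a _; rewrite lee_fin.
- by move=> a _; rewrite lee_fin sqrtr_ge0.
apply: le_esum => a _; rewrite -EFinM -EFinD lee_fin.
have := dhatG a; have := ler_norm (h ^+ s * G a - norm2 (dhat n a f)).
by rewrite distrC mulrDr; lra.
Qed.

Lemma sum_dhat_le_TV : (sum_dhat n f <= TV f + (C * h)%:E * H n f)%E.
Proof.
(* The step function must be truncated at 0 for [iint_floor] to apply. *)
pose P a := Num.max (G a - q a) 0.
have P0 a : 0 <= P a by rewrite le_max lexx orbT.
apply: (@le_trans _ _ (\esum_(a in [set: 'rV[int]_s])
   ((h ^+ s * P a)%:E + (C * (h * (h ^+ s * M a)))%:E))%E).
  apply: le_esum => a _; rewrite -EFinD lee_fin.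
  have := dhatG a; have := ler_norm (norm2 (dhat n a f) - h ^+ s * G a).
  have : h ^+ s * (G a - q a) <= h ^+ s * P a by rewrite ler_pM2l// le_max lexx.
  by rewrite mulrBr; lra.
rewrite esumD; first last.
- by move=> a _; rewrite lee_fin.
- by move=> a _; rewrite lee_fin mulr_ge0// ltW.
rewrite esumM// leeD2r//.
apply: (@le_trans _ _ (iint (fun x => (P (floor_mx (2 ^+ n) x))%:E))).
  rewrite (@iint_floor _ _ _ (fun a => (P a)%:E)) ?exprn_gt0//.
apply: le_iint => x; rewrite lee_fin ge_max sqrtr_ge0 andbT.
rewrite lerBlDl -lerBlDr; apply: le_trans (gradG x).
by rewrite distrC; exact: ler_norm.
Qed.
End Level.
End Main.

(* |a - b| <= c  (a, b in [0,+oo], c finite) is expressed as the pair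
   a <= b + c  and  b <= a + c. *)
Theorem theorem4p1 (R : realType) (s : nat) (hs : (1 <= s)%N)
  (f : 'rV[R]_s -> R) (hf : C2 f)
  (hH : exists m : nat, (H m f < +oo)%E) :
  forall n0 : nat, exists C : R, 0 < C /\
    forall n : nat, (n0 <= n)%N ->
      (sum_dhat n f <= TV f + (C * 2 ^- n)%:E * hess_int f)%E /\
      (TV f <= sum_dhat n f + (C * 2 ^- n)%:E * hess_int f)%E.
Proof.
move=> n0; have [m /H_bounded[K K0 HK]] := hH.
have Hn n : (H n f < +oo)%E by apply: le_lt_trans (HK n) _; rewrite ltry.
set D : R := 4 * s%:R ^+ 3 + s%:R ^+ 2.
have D0 : 0 <= D by rewrite addr_ge0// mulr_ge0// exprn_ge0.
have h0 n : 0 < (2 ^- n : R) by rewrite invr_gt0 exprn_gt0.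
(* Both comparisons carry the same error [D h H_n], so bounding it by the Hessian integral
   suffices. *)
suff [C C0 HC] : exists2 C : R, 0 < C &
    forall n, ((D * 2 ^- n)%:E * H n f <= (C * 2 ^- n)%:E * hess_int f)%E.
  exists C; split => // n _; split.
    by apply: le_trans (sum_dhat_le_TV hf (Hn n)) _; rewrite leeD2l.
  by apply: le_trans (TV_le_sum_dhat hf (Hn n)) _; rewrite leeD2l.
have : (0 <= hess_int f)%E by apply: iint_ge0 => x; rewrite lee_fin sqrtr_ge0.
case E : (hess_int f) => [r||//]; last first.
  (* An infinite Hessian integral makes the right-hand side infinite. *)
  move=> _; exists 1 => // n.
  by rewrite mul1r gt0_muley ?leey// lte_fin.
rewrite lee_fin le_eqVlt => /predU1P[r0|r0].
  exists 1 => // n; rewrite hess_int0_H//; last by rewrite E -r0.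
  by rewrite mule0 -r0 mule0.
(* Dividing by [r] cancels the Hessian integral; the [+ 1] keeps the constant positive when
   [K = 0]. *)
exists ((D * K + 1) / r); first by rewrite divr_gt0// ltr_wpDl// mulr_ge0.
move=> n; apply: (@le_trans _ _ ((D * 2 ^- n)%:E * K%:E)%E).
  by rewrite lee_wpmul2l// lee_fin mulr_ge0// ltW.
rewrite -!EFinM lee_fin.
have -> : (D * K + 1) / r * 2 ^- n * r = (D * K + 1) * 2 ^- n.
  by field; rewrite ?(gt_eqF r0) ?gt_eqF ?exprn_gt0.
by rewrite mulrAC ler_wpM2r ?(ltW (h0 n))// lerDl.
Qed.
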